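(* For all real numbers $x,y,z,w,t$, the equation $$\begin{aligned} \langle x,y,z,w,t\rangle ={}& \langle x,y,z,0,t\rangle+\langle x,y,0,w,t\rangle+\langle x,0,z,w,t\rangle+\langle 0,y,z,w,t\rangle\\ &-\langle x,y,0,0,t\rangle-\langle x,0,z,0,t\rangle-\langle x,0,0,w,t\rangle-\langle 0,y,z,0,t\rangle-\langle 0,y,0,w,t\rangle-\langle 0,0,z,w,t\rangle\\ &+\langle x,0,0,0,t\rangle+\langle 0,y,0,0,t\rangle+\langle 0,0,z,0,t\rangle+\langle 0,0,0,w,t\rangle-\langle 0,0,0,0,t\rangle \end{aligned}$$ is true in the geometric sense. That is, for every placement of the initial tetrahedron $\langle t\rangle=\langle 0,0,0,0,t\rangle$, the integer-valued function on $\mathbb{R}^3$ represented by the left-hand side equals, at every point of $\mathbb{R}^3$, the signed sum of the functions represented by the terms on the right-hand side.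
   Context: Fix a closed non-degenerate tetrahedron in $\mathbb{R}^3$ (not necessarily regular), with its four faces ordered; it and all its translates are denoted $\langle 1\rangle$. Let $\beta_1,\dots,\beta_4$ be its barycentric coordinates, so that each $\beta_i:\mathbb{R}^3\to\mathbb{R}$ is affine, $\beta_1+\beta_2+\beta_3+\beta_4=1$, the tetrahedron is $\{\beta_i\ge 0,\ i=1,\dots,4\}$, and its $i$-th face lies in the plane $\beta_i=0$. Write $\beta_i=c_i-\ell_i$ with $\ell_i$ linear and $c_i\in\mathbb{R}$. Then $\sum_i\ell_i=0$, $\sum_i c_i=1$, and $\langle 1\rangle=\{p:\ell_i(p)\le c_i,\ i=1,\dots,4\}$. Placed elements. For $(s_1,s_2,s_3,s_4)\in\mathbb{R}^4$ put $s=s_1+s_2+s_3+s_4$. The four planes $\ell_i=s_i$ determine a placed copy of the element $\langle s\rangle$, as follows. - If $s>0$, it is the closed tetrahedron $\{p:\ell_i(p)\le s_i\ \forall i\}$ (a homothetic image of $\langle 1\rangle$ with ratio $s$), counted with multiplicity $+1$. - If $s=0$, it is the single point $\{p:\ell_i(p)=s_i\ \forall i\}$, counted with multiplicity $+1$. - If $s<0$, it is the open tetrahedron (without faces, edges and vertices) $\{p:\ell_i(p)>s_i\ \forall i\}$ (oppositely oriented to $\langle 1\rangle$), counted with multiplicity $-1$. Each placed element is thus represented by an integer-valued function on $\mathbb{R}^3$, namely its multiplicity times the indicator function of the corresponding set. The element $-\langle s\rangle$ in the same position is represented by the negative of that function; thus $\langle s\rangle$ and $-\langle s\rangle$ laid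 on each other cancel to the empty set. The symbol $\langle x,y,z,w,t\rangle$. A placement of the initial element $\langle t\rangle$ is a choice of $(t_1,t_2,t_3,t_4)\in\mathbb{R}^4$ with $t_1+t_2+t_3+t_4=t$. With this placement fixed, $\langle x,y,z,w,t\rangle$ denotes the placed element determined by $(t_1+x,\,t_2+y,\,t_3+z,\,t_4+w)$. In other words, the four face planes of $\langle t\rangle$ are moved by $x,y,z,w$ respectively, outward for positive and inward for negative values, which produces an element of size $x+y+z+w+t$. The same placement $(t_1,t_2,t_3,t_4)$ is used for all terms of the equation. An equation $\langle x\rangle=\sum_j\alpha_j\langle x_j\rangle$ with $\alpha_j\in\{-1,1\}$ is true in the geometric sense if the tetrahedron $\langle x\rangle$ can be built from the placed elements $\alpha_j\langle x_j\rangle$ by superposition with cancellation, i.e. if the corresponding functions are equal. *)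

(* Defs.v *)
(* MathComp / MathComp-Analysis *)
From HB Require Import structures.
From mathcomp Require Import all_boot all_order all_algebra.
From mathcomp Require Import all_classical all_reals.
From mathcomp Require Import numfun.

Set Implicit Arguments.
Unset Strict Implicit.
Unset Printing Implicit Defensive.

Import Order.TTheory GRing.Theory Num.Theory.
Local Open Scope classical_set_scope.
Local Open Scope ring_scope.

(* A tetrahedron is given by its ordered vertices, and its i-th face is the one
   opposite to the vertex v i. *)
Definition affinely_independent (R : realType) (v : 'I_4 -> 'rV[R]_3) : Prop :=
  free [seq v (lift ord0 i) - v ord0 | i : 'I_3].

Definition barycentric (R : realType) (v : 'I_4 -> 'rV[R]_3)
    (beta : 'I_4 -> 'rV[R]_3 -> R) : Prop :=
  forall p, \sum_i beta i p = 1 /\ \sum_i beta i p *: v i = p.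

(* Point set and multiplicity of the element determined by the four planes
   ell i = s i. *)
Definition element_set (R : realType) (ell : 'I_4 -> {scalar 'rV[R]_3})
    (s : 'I_4 -> R) : set 'rV[R]_3 :=
  if 0 < \sum_i s i then [set p | forall i, ell i p <= s i]
  else if \sum_i s i == 0 then [set p | forall i, ell i p = s i]
  else [set p | forall i, ell i p > s i].

Definition multiplicity (R : realType) (s : 'I_4 -> R) : int :=
  if 0 <= \sum_i s i then 1 else -1.

Definition element (R : realType) (ell : 'I_4 -> {scalar 'rV[R]_3})
    (s : 'I_4 -> R) (p : 'rV[R]_3) : int :=
  multiplicity s * \1_(element_set ell s) p.

(* The symbol <x, y, z, w, t>, for the placement tau of <t>; the size t is
   the sum of the tau i. *)
Definition moved (R : realType) (ell : 'I_4 -> {scalar 'rV[R]_3})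
    (tau : 'I_4 -> R) (x y z w : R) : 'rV[R]_3 -> int :=
  element ell (fun i => tau i + [:: x; y; z; w]`_i).

(* Main.v *)
(* At a point p, the element with planes ell i = s i takes the value
   \prod_i b_i - \prod_i (1 - b_i), where b_i is 1 or 0 according to whether
   ell i p <= s i; this uses only \sum_i ell i = 0. The degree 4 terms cancel,
   and each b_i depends on s i alone, so the mixed fourth difference of this
   polynomial in the four displacements, which is the equation, vanishes. *)
Require Import Defs.
From HB Require Import structures.
From mathcomp Require Import all_boot all_order all_algebra.
From mathcomp Require Import all_classical all_reals.
From mathcomp Require Import numfun ring.

Import Order.TTheory GRing.Theory Num.Theory.
Local Open Scope ring_scope.

Lemma prodr_bool (I : finType) (S : comPzSemiRingType) (b : pred I) :
  \prod_i (b i)%:R = [forall i, b i]%:R :> S.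
Proof.
case: (boolP [forall i, b i]) => [/forallP bT|].
  by rewrite big1 // => i _; rewrite bT.
by rewrite negb_forall => /existsP[i /negbTE bF]; rewrite (bigD1 i) //= bF mul0r.
Qed.

(** Since the coordinates sum to 1 everywhere, [\sum_i ell i] takes the same value at [p] as at the
    origin, where every linear form vanishes. *)
Lemma barycentric_sum_ell (R : realType) (v : 'I_4 -> 'rV[R]_3)
    (beta : 'I_4 -> 'rV[R]_3 -> R) (c : 'I_4 -> R)
    (ell : 'I_4 -> {scalar 'rV[R]_3}) (p : 'rV[R]_3) :
  barycentric v beta -> (forall i q, beta i q = c i - ell i q) ->
  \sum_i ell i p = 0.
Proof.
move=> hbeta hell.
have sum_c q : \sum_i c i - \sum_i ell i q = 1.
  by rewrite -sumrB -(hbeta q).1; apply: eq_bigr => i _; rewrite hell.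
have ell0 : \sum_i ell i 0 = 0 by rewrite big1 // => i _; rewrite linear0.
have := sum_c p; rewrite -(sum_c 0) ell0 => /addrI/eqP.
by rewrite eqr_opp => /eqP.
Qed.

(** The size of the element equals the sum of the gaps [s i - ell i p]. Its sign therefore excludes
    one product: the first can be 1 only for size at least 0, the second only for negative size. The
    product left over is the indicator of the point set. *)
Lemma element_prod (R : realType) (ell : 'I_4 -> {scalar 'rV[R]_3})
    (s : 'I_4 -> R) (p : 'rV[R]_3) :
  \sum_i ell i p = 0 ->
  element ell s p =
    \prod_i (ell i p <= s i)%R%:R - \prod_i (1 - (ell i p <= s i)%R%:R).
Proof.
move=> ell0.
have -> : \prod_i (1 - (ell i p <= s i)%R%:R) =
    \prod_i (s i < ell i p)%R%:R :> int.
  by apply: eq_bigr => i _; rewrite ltNge; case: (_ <= _).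
rewrite !prodr_bool /element /multiplicity /element_set indicE.
have sum_s : \sum_i s i = \sum_i (s i - ell i p) by rewrite sumrB ell0 subr0.
have ge0 : [forall i, ell i p <= s i] -> 0 <= \sum_i s i.
  by move=> /forallP le_s; rewrite sum_s sumr_ge0 // => i _; rewrite subr_ge0.
have lt0 : [forall i, s i < ell i p] -> \sum_i s i < 0.
  move=> /forallP lt_s; rewrite -[ltRHS]ell0; apply: ltr_sum => //.
  (* Summing strict inequalities stays strict only over a nonempty index set. *)
  by apply/hasP; exists ord0; rewrite ?mem_index_enum.
have [s_gt0|s_lt0|s_eq0] := ltgtP 0 (\sum_i s i).
- have -> : [forall i, s i < ell i p] = false.
    by apply: contraTF s_gt0 => /lt0 /ltW; rewrite leNgt.
  rewrite subr0 mul1r; congr (_%:R); congr nat_of_bool.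
  by apply/idP/forallP; rewrite inE.
- have -> : [forall i, ell i p <= s i] = false.
    by apply: contraTF s_lt0 => /ge0; rewrite leNgt.
  rewrite sub0r mulN1r; congr (- _%:R); congr nat_of_bool.
  by apply/idP/forallP; rewrite inE.
- have -> : [forall i, s i < ell i p] = false.
    by apply/negP => /lt0; rewrite -s_eq0 ltxx.
  rewrite subr0 mul1r; congr (_%:R); congr nat_of_bool.
  apply/idP/forallP; rewrite inE /= => h i; first by rewrite h.
  (* At size 0 the nonnegative gaps sum to zero, so each of them vanishes: the closed inequalities
     already cut out the single point. *)
  have /eqP : \sum_i (s i - ell i p) = 0 by rewrite -sum_s.
  rewrite psumr_eq0 => [/allP/(_ i)|j _]; last by rewrite subr_ge0.
  by rewrite mem_index_enum subr_eq0 => /(_ isT)/eqP.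
Qed.

Theorem theorem2p3 (R : realType)
    (v : 'I_4 -> 'rV[R]_3) (hv : affinely_independent v)
    (beta : 'I_4 -> 'rV[R]_3 -> R) (hbeta : barycentric v beta)
    (c : 'I_4 -> R) (ell : 'I_4 -> {scalar 'rV[R]_3})
    (hell : forall i p, beta i p = c i - ell i p)
    (x y z w t : R) (tau : 'I_4 -> R) (htau : \sum_i tau i = t)
    (p : 'rV[R]_3) :
  moved ell tau x y z w p =
    moved ell tau x y z 0 p + moved ell tau x y 0 w p
    + moved ell tau x 0 z w p + moved ell tau 0 y z w p
    - moved ell tau x y 0 0 p - moved ell tau x 0 z 0 p
    - moved ell tau x 0 0 w p - moved ell tau 0 y z 0 p
    - moved ell tau 0 y 0 w p - moved ell tau 0 0 z w p
    + moved ell tau x 0 0 0 p + moved ell tau 0 y 0 0 p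
    + moved ell tau 0 0 z 0 p + moved ell tau 0 0 0 w p
    - moved ell tau 0 0 0 0 p.
Proof.
have ell0 : \sum_i ell i p = 0 by apply: barycentric_sum_ell hbeta hell.
(* Only eight truth values occur, two per face (displaced or not). With these as atoms, the goal is
   a polynomial identity over the integers. *)
rewrite /moved !element_prod // !big_ord_recl !big_ord0 /=.
ring.
Qed.
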